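(* Let $G$ be a periodic graph on $\mathbb{Z}^d\times S$ satisfying the standing assumptions in the context. Let $e_1,\dots,e_m$ be distinct edges of $G$, pick an orientation for each edge, and let $M$ be their transfer impedance matrix, i.e. the $m\times m$ matrix with $$D\,M(i,j)=g^{\delta_x-\delta_y}(z)-g^{\delta_x-\delta_y}(w),\qquad e_i=\vec{xy},\ e_j=\vec{zw},$$ where $g^{\delta_x-\delta_y}$ is a bounded solution $g$ of $(I-A)g=\delta_x-\delta_y$. If $\mathbf{T}$ is a uniform essential spanning forest of $G$ (a random subgraph with law $\mu_G$), then $$\mathbf{P}(e_1,\dots,e_m\in\mathbf{T})=\det(M).$$
   Context: Let $d,k\ge1$ and $S=\{1,\dots,k\}$. $G$ is an undirected graph with vertex set $\mathbb{Z}^d\times S$, possibly with parallel edges and self-edges, which is periodic: its edges (with multiplicity) are invariant under the translations $(x,i)\mapsto(x+a,i)$, $a\in\mathbb{Z}^d$. Standing assumptions: $G$ is connected, $D$-regular (every vertex has exactly $D<\infty$ incident edges counted with multiplicity, a self-edge being counted once), and has at least one self-edge (so that simple random walk on $G$ is aperiodic). The operator $A$ on complex functions on the vertices is $(Af)(x)=D^{-1}\sum_{y\sim x}f(y)$, with $y$ counted as many times as there are edges between $x$ and $y$. $\delta_x$ is the indicator function of the vertex $x$. For vertices $x,y$ a bounded solution of $(I-A)g=\delta_x-\delta_y$ exists and is unique up to an additive constant, so $M$ is well defined. The measure $\mu_G$ is the weak limit, as $n\to\infty$, of the uniform measures on spanning trees of the subgraph of $G$ induced on $\{(x,i):\|x\|_\infty\le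 n\}$ (if this induced subgraph is disconnected, one takes a uniformly random maximal spanning forest, i.e. an independent uniform spanning tree of each component). It is a probability measure on essential spanning forests of $G$: loopless spanning subgraphs all of whose components are infinite. *)

(* Defs.v *)
From HB Require Import structures.
From mathcomp Require Import all_boot all_order all_algebra finmap.
From mathcomp Require Import all_classical all_reals all_analysis.
From mathcomp Require Import complex.

Set Implicit Arguments.
Unset Strict Implicit.
Unset Printing Implicit Defensive.

Import Order.TTheory GRing.Theory Num.Theory.
Import numFieldNormedType.Exports.

Local Open Scope classical_set_scope.
Local Open Scope card_scope.
Local Open Scope ring_scope.

(* The vertex set Z^d x S, with S represented by {0, ..., k - 1}. *)
Notation vertex d k := ('rV[int]_d * 'I_k)%type.

(* Undirected multigraphs: [ends e] lists the two ends of [e] in an arbitrary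
   order, which carries no information; all the notions below only see [ends e]
   as an unordered pair. A self-edge has its two ends equal. *)
Record multigraph (V : choiceType) := Multigraph {
  edge : choiceType;
  ends : edge -> V * V
}.

Section Multigraph.
Variables (V : choiceType) (G : multigraph V).
Implicit Types (e : edge G) (x y z : V) (H T : edge G -> bool).

Definition joins e x y : bool := (ends e == (x, y)) || (ends e == (y, x)).

Definition incident e x : bool := (x == (ends e).1) || (x == (ends e).2).

(* The end of [e] opposite to its end [x]; it is [x] itself if [e] is a
   self-edge. Only meaningful when [x] is an end of [e]. *)
Definition other_end e x : V :=
  if x == (ends e).1 then (ends e).2 else (ends e).1.

(* A walk from [x] is the list of its successive steps (edge, next vertex). *)
Fixpoint walk x (p : seq (edge G * V)) : bool :=
  if p is (e, y) :: p' then joins e x y && walk y p' else true.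

Definition walk_end x (p : seq (edge G * V)) : V := last x (unzip2 p).

(* Spanning subgraphs are identified with their sets of edges. *)
Definition linked H x y : Prop :=
  exists p, [/\ walk x p, all H (unzip1 p) & walk_end x p = y].

(* Self-edges are cycles of length 1, pairs of parallel edges are cycles of
   length 2. *)
Definition acyclic H : Prop :=
  ~ exists x, exists p, [/\ p != [::], walk x p, walk_end x p = x,
      uniq (unzip1 p) /\ uniq (unzip2 p) & all H (unzip1 p)].

Definition connected_graph : Prop := forall x y, linked (fun=> true) x y.

(* A self-edge is counted once. *)
Definition regular (D : nat) : Prop :=
  forall x, [set e | incident e x] #= `I_D.

(* [T] restricts to a spanning tree on each connected component of [H]. *)
Definition maximal_spanning_forest H T : Prop :=
  [/\ forall e, T e -> H e,
      acyclic T
    & forall x y, linked H x y -> linked T x y].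

End Multigraph.

(* Random subgraphs live in {0, 1}^E, with the product topology and its Borel
   sigma-algebra. *)
Definition config (V : choiceType) (G : multigraph V) : Type :=
  {ptws edge G -> bool}.

Section ConfigInstances.
Variables (V : choiceType) (G : multigraph V).
HB.instance Definition _ := Pointed.copy (config G) {ptws edge G -> bool}.
HB.instance Definition _ := Topological.copy (config G) {ptws edge G -> bool}.
HB.instance Definition _ := Measurable.copy (config G)
  (g_sigma_algebraType (@open {ptws edge G -> bool})).
End ConfigInstances.

Section RandomSubgraphs.
Variables (R : realType) (V : choiceType) (G : multigraph V).

Definition uniform_on (A : set (config G)) (P : probability (config G) R) :
    Prop :=
  forall B : set (config G), measurable B ->
    P B = (#|` fset_set (A `&` B)|%:R / #|` fset_set A|%:R)%:E.

(* Continuous functions on the compact space [config G] are bounded. *)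
Definition weak_limit (Pn : nat -> probability (config G) R)
    (P : probability (config G) R) : Prop :=
  forall f : config G -> R, continuous f ->
    (\int[Pn n]_T (f T)%:E)%E @[n --> \oo] --> (\int[P]_T (f T)%:E)%E.

End RandomSubgraphs.

Section PeriodicGraphs.
Variables (d k : nat) (G : multigraph (vertex d k)).

Definition translate (a : 'rV[int]_d) (x : vertex d k) : vertex d k :=
  (x.1 + a, x.2).

Definition periodic : Prop :=
  forall (a : 'rV[int]_d) (x y : vertex d k),
    [set e : edge G | joins e x y] #=
    [set e : edge G | joins e (translate a x) (translate a y)].

Definition standing_assumptions (D : nat) : Prop :=
  [/\ periodic, connected_graph G, regular G D
    & exists (e : edge G) (x : vertex d k), joins e x x].

Definition in_box (n : nat) (x : vertex d k) : bool :=
  [forall i : 'I_d, `|x.1 0 i| <= n%:Z].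

Definition box_subgraph (n : nat) : config G :=
  fun e => in_box n (ends e).1 && in_box n (ends e).2.

(* [mu] is the measure mu_G. *)
Definition essential_forest_measure (R : realType)
    (mu : probability (config G) R) : Prop :=
  exists mun : nat -> probability (config G) R,
    (forall n, uniform_on (maximal_spanning_forest (box_subgraph n)) (mun n))
    /\ weak_limit mun mu.

Section Impedance.
Local Open Scope complex_scope.
Variables (R : realType) (D : nat).

(* Summing over the edges at [x] counts each neighbor with multiplicity. *)
Definition transition (f : vertex d k -> R[i]) (x : vertex d k) : R[i] :=
  D%:R^-1 * \sum_(e \in [set e : edge G | incident e x]) f (other_end e x).

Definition delta (x v : vertex d k) : R[i] := (v == x)%:R.

(* [g] is a bounded solution of (I - A) g = delta_x - delta_y. *)
Definition bounded_solution (x y : vertex d k) (g : vertex d k -> R[i]) :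
    Prop :=
  (exists B : R, forall v, `|g v| <= B%:C) /\
  (forall v, g v - transition g v = delta x v - delta y v).

(* [M] is the transfer impedance matrix of the oriented edges from [x i] to
   [y i]; the potential difference does not depend on the choice of [g]. *)
Definition transfer_impedance (m : nat) (x y : 'I_m -> vertex d k)
    (M : 'M[R[i]]_m) : Prop :=
  forall i j, exists2 g, bounded_solution (x i) (y i) g &
    D%:R * M i j = g (x j) - g (y j).

End Impedance.
End PeriodicGraphs.

(* Main.v *)
(* In a finite graph, fix a maximal spanning forest with edges f_1, .., f_r. The
   gradients on all edges are integer combinations of the gradients on the f_j;
   let C be the matrix of coefficients. An r-set of edges is a maximal spanning
   forest exactly when the corresponding minor of C is nonzero, and that minor is
   then 1 or -1. The projection K = C (C^T C)^-1 C^T is the transfer impedance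
   matrix, since K(e, .) is the gradient of a potential generated by a unit current
   through e. Because K is a projection of rank r, the minors det K(S, S) satisfy,
   when summed over the one-edge extensions of S, the same recursion as the number
   of maximal spanning forests containing S, so these are proportional.

   On the boxes of the periodic graph the potentials take values in an interval of
   length 1. By Tychonoff's theorem they accumulate at bounded solutions of the
   Poisson equation on the whole graph, which are unique up to constants by
   Liouville's theorem (a consequence of the Harnack inequality and periodicity).
   Hence the finite-volume determinants converge to det M, and their limit is also
   the probability of the cylinder event, by weak convergence. *)

Require Import Defs.
From HB Require Import structures.
From mathcomp Require Import all_boot all_order all_algebra finmap.
From mathcomp Require Import all_classical all_reals all_analysis.
From mathcomp Require Import complex.
From mathcomp Require Import ring lra zify.

Set Implicit Arguments.
Unset Strict Implicit.
Unset Printing Implicit Defensive.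

Import Order.TTheory GRing.Theory Num.Theory.
Import numFieldNormedType.Exports.

Local Open Scope classical_set_scope.
Local Open Scope ring_scope.

(** * Walks and forests *)

Section Walks.
Variables (V : choiceType) (G : multigraph V).
Implicit Types (e : edge G) (x y z : V) (H T : edge G -> bool).

Lemma joinsC e x y : joins e x y = joins e y x.
Proof. exact: orbC. Qed.

Lemma joins_ends e : joins e (ends e).1 (ends e).2.
Proof. by rewrite /joins -surjective_pairing eqxx. Qed.

Lemma joins_incidentl e x y : joins e x y -> incident e x.
Proof. by case/orP=> /eqP; rewrite /incident => -> /=; rewrite eqxx ?orbT. Qed.

Lemma joins_incidentr e x y : joins e x y -> incident e y.
Proof. by rewrite joinsC; exact: joins_incidentl. Qed.

Lemma incident_joins e x y z : joins e x y -> incident e z -> z = x \/ z = y.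
Proof.
case/orP=> /eqP; rewrite /incident => -> /= /orP[]/eqP ->; by [left|right].
Qed.

Lemma joins_other_end e x y : incident e x -> joins e x y = (other_end e x == y).
Proof.
rewrite /incident /joins /other_end; case: (ends e) => a b /=.
rewrite !xpair_eqE; case: (eqVneq x a) => [<- _|xa /= /eqP <-].
  by rewrite /=; case: (eqVneq b y) => //= /negPf bNy; apply/andP => -[/eqP ->]; rewrite bNy.
by rewrite eqxx andbT.
Qed.

Lemma linked_refl H x : linked H x x.
Proof. by exists [::]. Qed.

Lemma linked_cons H e x y z :
  joins e x y -> H e -> linked H y z -> linked H x z.
Proof.
move=> exy He [p [wp Hp pz]]; exists ((e, y) :: p); split => //=.
- by rewrite exy.
- by rewrite He.
Qed.

Lemma linked_edge H e x y : joins e x y -> H e -> linked H x y.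
Proof. by move=> exy He; exact: (linked_cons exy He (linked_refl _ _)). Qed.

Lemma linked_ind H (Q : V -> V -> Prop) :
  (forall x, Q x x) ->
  (forall e x y z, joins e x y -> H e -> linked H y z -> Q y z -> Q x z) ->
  forall x y, linked H x y -> Q x y.
Proof.
move=> Q0 QS x y [p [wp Hp <-]].
elim: p x wp Hp => [|[e z] p IHp] x /=; first by [].
move=> /andP[exz wp] /andP[He Hp].
by apply: (QS e _ z) (IHp _ wp Hp) => //; exists p.
Qed.

Lemma linked_trans H x y z : linked H x y -> linked H y z -> linked H x z.
Proof.
move: x y; apply: (@linked_ind _ (fun x y => linked H y z -> linked H x z)) => //.
by move=> e x y t exy He _ IH /IH; exact: linked_cons exy He.
Qed.

Lemma linked_sym H x y : linked H x y -> linked H y x.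
Proof.
move: x y; apply: linked_ind => [x|e x y z exy He _ IH]; first exact: linked_refl.
by apply: linked_trans IH (linked_edge _ He); rewrite joinsC.
Qed.

Lemma linked_const (A : Type) (u : V -> A) H x y :
  (forall e a b, H e -> joins e a b -> u a = u b) -> linked H x y -> u x = u y.
Proof.
move=> uH; move: x y; apply: linked_ind => // e x y z exy He _ <-.
exact: uH exy.
Qed.

Lemma walk_incident e x (p : seq (edge G * V)) y : walk x p -> e \in unzip1 p -> incident e y ->
  y \in x :: unzip2 p.
Proof.
elim: p x => //= -[f z] p IHp x /= /andP[fxz wp].
rewrite in_cons => /orP[/eqP ->|ep] ey.
  by case: (incident_joins fxz ey) => ->; rewrite !in_cons eqxx ?orbT.
by rewrite in_cons (IHp z) ?orbT.
Qed.

Lemma walk_uniq x (p : seq (edge G * V)) : walk x p -> uniq (x :: unzip2 p) -> uniq (unzip1 p).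
Proof.
elim: p x => //= -[e z] p IHp x /= /andP[exz wp] /andP[xp up].
rewrite (IHp z) // andbT; apply: contra xp => ep.
exact: walk_incident wp ep (joins_incidentl exz).
Qed.

(** Loop erasure: when a new first vertex already lies on the simple walk, the part before that
    visit is dropped. *)
Lemma linked_uniq H x y : linked H x y -> exists p : seq (edge G * V), [/\ walk x p,
  all H (unzip1 p), walk_end x p = y & uniq (x :: unzip2 p)].
Proof.
move: x y; apply: linked_ind => [x|e x y z exy He _ [p [wp Hp pz up]]].
  by exists [::].
case: (boolP (x \in y :: unzip2 p)) => [xp|xp]; last first.
  by exists ((e, y) :: p); split=> //=; rewrite ?exy ?He //= xp.
elim: p y xp wp Hp pz up {exy} => [|[f t] p IHp] y /=.
  rewrite mem_seq1 => /eqP <- _ _ xz _; by exists [::].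
rewrite in_cons => /orP[/eqP ->|xp] wp Hp pz up.
  by exists ((f, t) :: p); split.
case/andP: wp => _ wp; case/andP: Hp => _ Hp; case/andP: up => _ up.
exact: IHp xp wp Hp pz up.
Qed.

(** A cycle amounts to an edge whose ends stay linked once it is removed: a simple walk between the
    ends is closed up by the edge. *)
Lemma acyclicP T : acyclic T <-> forall e x y, T e -> joins e x y ->
  ~ linked (fun f => T f && (f != e)) x y.
Proof.
split=> [acT e x y Te exy /linked_uniq[p [wp Tp py up]]|acT].
  apply: acT; exists y, ((e, x) :: p); split => //=.
  - by rewrite joinsC exy.
  - split=> //=; rewrite (walk_uniq wp up) andbT.
    by apply/negP => ep; move/allP: Tp => /(_ _ ep); rewrite eqxx andbF.
  - by rewrite Te; apply: sub_all Tp => f /andP[].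
move=> [x [[|[e z] p] []]] //= _ /andP[exz wp] px [/andP[ep _] _] /andP[Te Tp].
apply: (acT e x z Te exz); apply: linked_sym; exists p; split=> //.
apply/allP => f fp; rewrite (allP Tp _ fp) /=; apply: contraNneq ep => <-.
exact: fp.
Qed.

End Walks.

(** * Discrete gradients, with forests as bases *)

Section Potentials.
Variables (R : realType) (V : choiceType) (G : multigraph V).
Variable o : edge G -> V * V.
Hypothesis ho : forall e, joins e (o e).1 (o e).2.
Implicit Types (e f : edge G) (x y z : V) (H T : edge G -> bool) (u v : V -> R).

Definition grad v e : R := v (o e).1 - v (o e).2.

(* When [T] is a forest containing [e], the indicator function of the component
   of the tail of [e] in [T] minus [e]. *)
Definition branch T e : V -> R :=
  fun z => `[< linked (fun f => T f && (f != e)) (o e).1 z >]%:R.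

Definition im n (f : 'I_n -> edge G) : edge G -> bool := fun e => e \in codom f.

(** By [grad_expand], for a basis [f] and edges [g i] of [H], row [i] expresses every gradient on
    [g i] through the gradients on the [f j]. *)
Definition coefmx r m (f : 'I_r -> edge G) (g : 'I_m -> edge G) : 'M[R]_(m, r) :=
  \matrix_(i, j) grad (branch (im f) (f j)) (g i).

Lemma joins_orient (A : Type) (h : V -> A) e a b : joins e a b ->
  h a = h b <-> h (o e).1 = h (o e).2.
Proof.
have := ho e; rewrite /joins.
by case/orP=> /eqP -> /orP[] /eqP[<- <-].
Qed.

Lemma grad_linked v H x y :
  (forall e, H e -> grad v e = 0) -> linked H x y -> v x = v y.
Proof.
move=> vH; apply: linked_const => e a b He eab; apply/(joins_orient v eab).
by apply/eqP; rewrite -subr_eq0; apply/eqP; exact: vH.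
Qed.

Lemma im_f n (f : 'I_n -> edge G) i : im f (f i).
Proof. exact: codom_f. Qed.

Lemma imP n (f : 'I_n -> edge G) e : im f e -> exists i, e = f i.
Proof. by case/codomP=> i ->; exists i. Qed.

Lemma grad_indicator_linked H x e : H e ->
  grad (fun z => `[< linked H x z >]%:R) e = 0.
Proof.
move=> He; apply/eqP; rewrite subr_eq0; apply/eqP; congr (nat_of_bool _)%:R.
have l := linked_edge (ho e) He.
by apply/asboolP/asboolP => /linked_trans; apply=> //; exact: linked_sym.
Qed.

(** Removing [e] from the forest separates the ends of [e], while every other edge of [T] stays
    inside one component. *)
Lemma grad_branch T e f : acyclic T -> T e -> T f -> grad (branch T e) f = (f == e)%:R.
Proof.
move=> acT Te Tf; case: (eqVneq f e) => [->|fe]; last first.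
  by apply: grad_indicator_linked; rewrite Tf.
rewrite /grad /branch; case: asboolP => [_|[]]; last exact: linked_refl.
by case: asboolP => [|_]; [move/acyclicP: acT => /(_ _ _ _ Te (ho e))|rewrite subr0].
Qed.

Lemma grad_branch_int T e f : grad (branch T e) f \is a Num.int.
Proof. by apply: rpredB; exact: natr_int. Qed.

Section Bases.
Variables (H : edge G -> bool).
Definition forest_basis r (f : 'I_r -> edge G) : Prop :=
  injective f /\ maximal_spanning_forest H (im f).

Lemma grad_basis r (f : 'I_r -> edge G) i j : forest_basis f ->
  grad (branch (im f) (f j)) (f i) = (i == j)%:R.
Proof.
move=> [fI [_ acf _]]; rewrite grad_branch ?im_f//.
by rewrite (inj_eq fI).
Qed.

(** Subtracting the combination of branches from [v] leaves zero gradient on the basis, hence a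
    function constant on the components of [H]. *)
Lemma grad_expand r (f : 'I_r -> edge G) v e : forest_basis f -> H e ->
  grad v e = \sum_i grad (branch (im f) (f i)) e * grad v (f i).
Proof.
move=> bf He; have [fI [_ _ lf]] := bf.
pose v' z := v z - \sum_i branch (im f) (f i) z * grad v (f i).
have gv' e' : grad v' e' =
    grad v e' - \sum_i grad (branch (im f) (f i)) e' * grad v (f i).
  rewrite {1}/grad /v'; under [X in _ = _ - X]eq_bigr do rewrite {1}/grad mulrBl.
  by rewrite sumrB /grad; ring.
apply/eqP; rewrite -subr_eq0 -gv' subr_eq0; apply/eqP.
apply: (@grad_linked v' (im f)); last exact: lf (linked_edge (ho e) He).
move=> _ /imP[i ->]; rewrite gv' (bigD1 i) //= grad_basis // eqxx mul1r.
rewrite big1 ?addr0 ?subrr // => j ji.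
by rewrite grad_basis // eq_sym (negPf ji) mul0r.
Qed.

Lemma coefmx_id r (f : 'I_r -> edge G) : forest_basis f -> coefmx f f = 1%:M.
Proof. by move=> bf; apply/matrixP => i j; rewrite !mxE grad_basis. Qed.

Lemma coefmx_mul r r' m (f : 'I_r -> edge G) (f' : 'I_r' -> edge G)
    (g : 'I_m -> edge G) : forest_basis f -> (forall i, H (g i)) ->
  coefmx f g *m coefmx f' f = coefmx f' g.
Proof.
move=> bf gH; apply/matrixP => i j; rewrite !mxE (grad_expand _ bf) //.
by apply: eq_bigr => k _; rewrite !mxE.
Qed.

Lemma forest_basis_mem r (f : 'I_r -> edge G) i : forest_basis f -> H (f i).
Proof. by case=> _ [Hf _ _]; apply: Hf; exact: im_f. Qed.

(** The two change-of-basis matrices have identity products, so rank bounds each size by the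
    other. *)
Lemma basis_size r r' (f : 'I_r -> edge G) (f' : 'I_r' -> edge G) :
  forest_basis f -> forest_basis f' -> r = r'.
Proof.
move=> bf bf'; apply/eqP; rewrite eqn_leq.
apply/andP; split.
- apply: (@mulmx1_min R _ _ (coefmx f' f) (coefmx f f')).
  by rewrite (coefmx_mul _ bf') ?coefmx_id // => i; exact: forest_basis_mem.
- apply: (@mulmx1_min R _ _ (coefmx f f') (coefmx f' f)).
  by rewrite (coefmx_mul _ bf) ?coefmx_id // => i; exact: forest_basis_mem.
Qed.

Lemma det_int n (A : 'M[R]_n) : (forall i j, A i j \is a Num.int) ->
  \det A \is a Num.int.
Proof.
move=> Ai; rewrite /determinant rpred_sum // => s _.
by rewrite rpredMsign rpred_prod.
Qed.

(* [coefmx f f'] and [coefmx f' f] are mutually inverse integer matrices. *)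
Lemma det_coefmx_basis r (f f' : 'I_r -> edge G) :
  forest_basis f -> forest_basis f' -> \det (coefmx f f') ^+ 2 = 1.
Proof.
move=> bf bf'; set a := \det _; pose b := \det (coefmx f' f).
have ab : a * b = 1.
  by rewrite -det_mulmx (coefmx_mul _ bf) ?coefmx_id ?det1 // => i; exact: forest_basis_mem.
have [ai bi] : a \is a Num.int /\ b \is a Num.int.
  by split; apply: det_int => i j; rewrite mxE grad_branch_int.
have [a0 b0] : a != 0 /\ b != 0.
  by split; apply: contra_eq_neq ab => ->; rewrite ?mul0r ?mulr0 eq_sym oner_eq0.
have a1 := norm_intr_ge1 ai a0; have b1 := norm_intr_ge1 bi b0.
have : `|a| * `|b| = 1 by rewrite -normrM ab normr1.
move=> nab; have na : `|a| = 1.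
  apply/eqP; rewrite eq_le a1 andbT -nab ler_peMr //.
by rewrite -real_normK ?num_real // na expr1n.
Qed.

(** If the matrix were invertible, the gradients on [g] could be prescribed freely, which excludes
    cycles, and would determine those on [f], which makes [g] link whatever [H] links. *)
Lemma det_coefmx_nonbasis r (f g : 'I_r -> edge G) : forest_basis f ->
  injective g -> (forall i, H (g i)) -> ~ maximal_spanning_forest H (im g) ->
  \det (coefmx f g) = 0.
Proof.
move=> bf gI gH ng; apply/eqP; apply: contra_notT ng => d0.
have U : coefmx f g \in unitmx by rewrite unitmxE unitfE.
have gradC v : coefmx f g *m (\col_i grad v (f i)) = \col_i grad v (g i).
  apply/matrixP => i j; rewrite !mxE (grad_expand _ bf) //.
  by apply: eq_bigr => k _; rewrite !mxE.
split; first by move=> _ /imP[i ->].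
- apply/acyclicP => _ x y /imP[i ->] gxy lxy.
  (* The resulting [v] has gradient 1 on [g i] and 0 on the other [g j], so no walk through the
     others joins the ends of [g i]. *)
  pose w : 'cV[R]_r := invmx (coefmx f g) *m delta_mx i 0.
  pose v z := \sum_k branch (im f) (f k) z * w k 0.
  have gv j : grad v (g j) = (j == i)%:R.
    transitivity ((coefmx f g *m w) j 0).
      rewrite /grad /v -sumrB mxE; apply: eq_bigr => k _.
      by rewrite [coefmx f g j k]mxE /grad mulrBl.
    by rewrite mulKVmx // mxE eqxx andbT.
  have : v x = v y.
    apply: grad_linked lxy => e /andP[/imP[j ->]]; rewrite gv.
    by rewrite (inj_eq gI) => /negPf ->.
  move/(joins_orient v gxy)/eqP; rewrite -subr_eq0 -/(grad _ _) gv eqxx.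
  by rewrite oner_eq0.
- move=> x y; apply: linked_ind => [a|e a b c eab He _]; first exact: linked_refl.
  apply: linked_trans; apply: contrapT => nab.
  (* This indicator has zero gradient on [g], hence on [f], hence on [e]; it cannot separate [a]
     from [b]. *)
  pose v z := `[< linked (im g) a z >]%:R : R.
  have v0 : \col_i grad v (f i) = 0.
    apply: (can_inj (mulKmx U)); rewrite mulmx0 gradC.
    by apply/matrixP => i j; rewrite !mxE grad_indicator_linked // im_f.
  have : v a = v b.
    apply/(joins_orient v eab)/eqP; rewrite -subr_eq0 -/(grad _ _).
    rewrite (grad_expand _ bf He) big1 // => i _.
    by move/matrixP: v0 => /(_ i 0); rewrite !mxE => ->; rewrite mulr0.
  rewrite /v; case: asboolP => [_|[]]; last exact: linked_refl.
  by case: asboolP => // _ /eqP; rewrite oner_eq0.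
Qed.

End Bases.
End Potentials.

(** * Spanning forests and determinants *)

(** Schur complement without division: a block triangular factor built from [\adj A] clears [u], and
    the resulting power of [\det A] is cancelled. *)
Lemma det_bordered_neq0 (R : idomainType) n (A : 'M[R]_n) (u : 'cV[R]_n)
    (v : 'rV[R]_n) (c : 'M[R]_1) : \det A != 0 ->
  \det (block_mx A u v c) = \det A * c 0 0 - (v *m \adj A *m u) 0 0.
Proof.
move=> dA; apply: (mulIf (expf_neq0 n dA)).
have dadj : \det (\adj A) * \det A = \det A ^+ n.
  by rewrite mulrC -det_mulmx mul_mx_adj det_scalar.
rewrite -{1}dadj -[X in _ * (_ * X) = _](det_scalar1 (\det A)).
rewrite -(det_ublock (\adj A) (- (\adj A *m u))) -det_mulmx mulmx_block.
rewrite !mulmx0 !addr0 mul_mx_adj mulmxN mulmxA mul_mx_adj.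
rewrite mul_scalar_mx mul_mx_scalar addNr mulmxN det_lblock det_scalar.
rewrite mulrC; congr (_ * _); rewrite [X in \det X]mx11_scalar det_scalar1.
by rewrite mul_mx_scalar mulmxA mxE addrC mxE [in X in _ + X]mxE.
Qed.

(* Both sides are polynomial in [A], so [A] may be perturbed to [A + t], whose
   determinant is a nonzero polynomial in [t]. *)
Lemma det_bordered (R : idomainType) n (A : 'M[R]_n) (u : 'cV[R]_n) (v : 'rV[R]_n)
    (c : 'M[R]_1) :
  \det (block_mx A u v c) = \det A * c 0 0 - (v *m \adj A *m u) 0 0.
Proof.
pose A' := char_poly_mx (- A).
have eA : map_mx (horner_eval 0) A' = A.
  apply/matrixP => i j; rewrite !mxE /horner_eval /= !hornerE /=.
  by rewrite hornerMn hornerX mul0rn sub0r opprK.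
have ep m p (B : 'M[R]_(m, p)) : map_mx (horner_eval 0) (map_mx polyC B) = B.
  by apply/matrixP => i j; rewrite !mxE /horner_eval hornerC.
have dA' : \det A' != 0 by apply: monic_neq0; exact: char_poly_monic.
have := det_bordered_neq0 (map_mx polyC u) (map_mx polyC v) (map_mx polyC c) dA'.
move=> /(congr1 (horner_eval 0)).
rewrite rmorphB rmorphM /= -!det_map_mx map_block_mx !ep eA => ->.
congr (_ * _ - _); first by rewrite mxE /horner_eval hornerC.
transitivity ((map_mx (horner_eval 0) (map_mx polyC v *m \adj A' *m map_mx polyC u)) 0 0).
  by rewrite [RHS]mxE.
by rewrite !map_mxM map_mx_adj !ep eA.
Qed.

(** Each bordered determinant is linear in the rank-one matrix of [c z]. These matrices sum to the
    inverse of [Q], which leaves the traces of the identity, [r], and of [\adj A *m A], that is [m]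
    times [\det A]. *)
Lemma sum_det_bordered (R : idomainType) (I : Type) (s : seq I) (r m : nat)
    (c : I -> 'rV[R]_r) (Q : 'M[R]_r) (X : 'M[R]_(m, r)) :
    Q *m (\sum_(z <- s) (c z)^T *m c z) = 1%:M ->
  \sum_(z <- s) \det (col_mx X (c z) *m Q *m (col_mx X (c z))^T)
    = (r%:R - m%:R) * \det (X *m Q *m X^T).
Proof.
move=> QG; set G := \sum_(z <- s) _ in QG; set A := X *m Q *m X^T.
transitivity (\sum_(z <- s) (\det A * \tr (Q *m ((c z)^T *m c z)) -
    \tr (Q *m X^T *m \adj A *m X *m Q *m ((c z)^T *m c z)))).
  apply: eq_bigr => z _.
  rewrite tr_col_mx mul_col_mx mul_col_row det_bordered; congr (_ * _ - _).
    by rewrite mulmxA mxtrace_mulC mulmxA /mxtrace big_ord1.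
  rewrite [X in _ = \tr X]mulmxA mxtrace_mulC.
  by rewrite /mxtrace big_ord1 !mulmxA.
have trG Y : \sum_(z <- s) \tr (Y *m ((c z)^T *m c z)) = \tr (Y *m G).
  by rewrite mulmx_sumr raddf_sum.
rewrite sumrB -mulr_sumr !trG QG mxtrace1 -!mulmxA QG mulmx1 mxtrace_mulC -!mulmxA mxtrace_mulC.
rewrite -mulmxA -/A.
by rewrite mul_adj_mx mxtrace_scalar -mulr_natr; ring.
Qed.

(** * Counting spanning forests by principal minors *)

Section ForestCount.
Variables (R : realType) (V : choiceType) (G : multigraph V).
Variable o : edge G -> V * V.
Hypothesis ho : forall e, joins e (o e).1 (o e).2.
Variables (H : {fset edge G}) (B : {fset config G}).
Hypothesis hB : forall T : config G,
  T \in B <-> maximal_spanning_forest (mem H) T.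
Implicit Types (e f : edge G) (u v : V -> R).

Let inH : edge G -> bool := mem H.
Let coefmx r m := @coefmx R V G o r m.
Let forest_basis r := @forest_basis V G inH r.

Lemma codom_uniq (I : finType) (A : eqType) (f : I -> A) : injective f -> uniq (codom f).
Proof. by move=> fI; rewrite map_inj_uniq ?enum_uniq. Qed.

Lemma forest_enum (T : config G) : T \in B ->
  exists r, exists2 f : 'I_r -> edge G, forest_basis f & T = im f.
Proof.
move=> /hB hT; have [TH _ _] := hT.
pose s := [seq e <- H | T e]; pose f := tnth (in_tuple s).
have cf : codom f = s by rewrite codomE map_tnth_enum.
have ET : T = im f.
  apply/funext => e; rewrite /im cf mem_filter.
  by case: (boolP (T e)) => //= /TH eH; apply/esym.
exists (size s), f => //; split; last by rewrite -ET.
by apply/injectiveP; rewrite /injectiveb /dinjectiveb -codomE cf filter_uniq ?fset_uniq.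
Qed.

Lemma im_contained r m (f : 'I_r -> edge G) (g : 'I_m -> edge G) :
  injective g -> (forall i, im f (g i)) -> (m <= r)%N /\ (m = r -> im f = im g).
Proof.
move=> gI gf; have sub : {subset codom g <= codom f} by move=> _ /codomP[i ->]; exact: gf.
have := uniq_leq_size (codom_uniq gI) sub; rewrite !size_codom !card_ord => mr.
split=> // emr; apply/funext => e; apply/esym.
have sz : (size (codom f) <= size (codom g))%N by rewrite !size_codom !card_ord emr.
by have [_ /(_ e)] := uniq_min_size (codom_uniq gI) sub sz.
Qed.

Lemma sum_im n (f : 'I_n -> edge G) : injective f -> (forall i, inH (f i)) ->
  \sum_(z <- H) (im f z)%:R = n%:R :> R.
Proof.
move=> fI fH; rewrite (eq_bigr (fun z => if im f z then 1 else 0)); last by move=> z _; case: ifP.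
rewrite -big_mkcond -big_filter (perm_big (codom f)) /=.
  by rewrite big_const_seq count_predT size_codom card_ord iter_addr_0.
apply: uniq_perm; rewrite ?filter_uniq ?fset_uniq ?codom_uniq // => z.
rewrite mem_filter {1}/im; case: (boolP (z \in codom f)) => //= /codomP[i ->].
exact: fH.
Qed.

Definition extend m (g : 'I_m -> edge G) z : 'I_(m + 1) -> edge G :=
  fun i => match fintype.split i with inl j => g j | inr _ => z end.

Lemma extend_lshift m (g : 'I_m -> edge G) z i : extend g z (lshift 1 i) = g i.
Proof. by rewrite /extend (unsplitK (inl i)). Qed.

Lemma extend_rshift m (g : 'I_m -> edge G) z i : extend g z (rshift m i) = z.
Proof. by rewrite /extend (unsplitK (inr i)). Qed.

Lemma extendP m (g : 'I_m -> edge G) z (P : edge G -> Prop) :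
  (forall i, P (extend g z i)) <-> (forall i, P (g i)) /\ P z.
Proof.
split=> [h|[hg hz] i]; last by rewrite /extend; case: fintype.split.
split=> [i|]; first by rewrite -(extend_lshift g z).
by rewrite -(extend_rshift g z ord0).
Qed.

Lemma extend_inj m (g : 'I_m -> edge G) z : injective g -> z \notin codom g ->
  injective (extend g z).
Proof.
move=> gI zg i j; rewrite -(splitK i) -(splitK j).
case: (fintype.split i) => [i'|i'] /=; case: (fintype.split j) => [j'|j'] /=;
  rewrite ?extend_lshift ?extend_rshift.
- by move=> /gI ->.
- by move=> gz; rewrite -gz codom_f in zg.
- by move=> gz; rewrite gz codom_f in zg.
- by rewrite !ord1.
Qed.

Definition forests_containing m (g : 'I_m -> edge G) : R :=
  \sum_(T <- B) [forall i, T (g i)]%:R.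

Section WithBasis.
Variables (r : nat) (f : 'I_r -> edge G).
Hypothesis bf : forest_basis f.

Lemma forest_enum_basis (T : config G) : T \in B ->
  exists2 f' : 'I_r -> edge G, forest_basis f' & T = im f'.
Proof.
move=> /forest_enum[r' [f' bf' Tf]].
have rr : r' = r by apply: basis_size bf' bf.
by move: f' bf' Tf; rewrite rr => f' *; exists f'.
Qed.

(** Double counting of pairs [(z, T)]: a forest has [r] edges, so one that contains [g] has [r - m]
    further edges. *)
Lemma forests_extend m (g : 'I_m -> edge G) : injective g ->
    (forall i, inH (g i)) ->
  \sum_(z <- H) (if z \in codom g then 0 else forests_containing (extend g z))
  = (r%:R - m%:R) * forests_containing g.
Proof.
move=> gI gH; rewrite mulr_sumr.
transitivity (\sum_(z <- H) \sum_(T <- B)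
    [forall i, T (g i)]%:R * ((T z)%:R - (im g z)%:R) : R).
  apply: eq_bigr => z _; case: ifPn => zg.
    rewrite big1 // => T _; rewrite /im zg.
    case: forallP => [gT|]; last by rewrite mul0r.
    by case/codomP: zg => i ->; rewrite gT subrr mulr0.
  apply: eq_bigr => T _; rewrite /im (negPf zg) subr0 -natrM mulnb.
  congr (nat_of_bool _)%:R; apply/forallP/andP.
    by move=> /(extendP g z T)[gT Tz]; split=> //; apply/forallP.
  by move=> [/forallP gT Tz]; apply/(extendP g z T).
rewrite exchange_big /=; apply: eq_big_seq => T TB; rewrite -mulr_sumr mulrC.
case: forallP => [gT|]; last by rewrite !mulr0.
have [f' bf' ->] := forest_enum_basis TB.
have [f'I _] := bf'.
by rewrite sumrB (sum_im gI gH) (sum_im f'I) // => i; exact: (forest_basis_mem i bf').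
Qed.

(** A forest has [r] edges, so only [im g] itself can contain [g]; the squared determinant is 1 or 0
    according to whether [im g] is a maximal spanning forest. *)
Lemma forests_basis (g : 'I_r -> edge G) : injective g -> (forall i, inH (g i)) ->
  forests_containing g = \det (coefmx f g) ^+ 2.
Proof.
move=> gI gH; rewrite /forests_containing.
rewrite (eq_big_seq (fun T => (T == im g)%:R)); last first.
  move=> T /forest_enum_basis[f' bf' ->]; congr (nat_of_bool _)%:R.
  apply/forallP/eqP => [fg|-> i]; last exact: im_f.
  by have [_ ->] := im_contained gI fg.
case: (boolP ((im g : config G) \in B)) => [gB|gB].
  have bg : forest_basis g by split=> //; apply/hB.
  rewrite (det_coefmx_basis R ho bf bg) (bigD1_seq (im g : config G)) ?fset_uniq //=.
  by rewrite eqxx big1 ?addr0 // => T /negPf ->.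
rewrite (det_coefmx_nonbasis R ho bf gI gH) ?expr0n /=; last first.
  by move=> /hB; apply/negP.
rewrite big_seq big1 // => T TB; case: eqP => // ET; by rewrite -ET TB in gB.
Qed.

Definition coefrow e : 'rV[R]_r := coefmx f (fun=> e).
(** This is [C^T C] for the coefficient matrix [C] of all edges of [H], split into rank-one
    terms. *)
Definition gram : 'M[R]_r := \sum_(z <- H) (coefrow z)^T *m coefrow z.

(** The quadratic form of [gram] is a sum of squares, among them the squares of the coordinates,
    contributed by the basis edges. *)
Lemma gram_unit : gram \in unitmx.
Proof.
suff inj (x : 'rV_r) : x *m gram = 0 -> x = 0.
  rewrite -row_free_unit -kermx_eq0; apply/eqP/row_matrixP => k.
  by rewrite row0; apply: inj; apply/sub_kermxP; exact: row_sub.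
move=> /(congr1 (fun A => (A *m x^T) 0 0)).
rewrite mul0mx [RHS]mxE /gram mulmx_sumr mulmx_suml summxE.
rewrite (eq_bigr (fun z => ((coefrow z *m x^T) 0 0) ^+ 2)); last first.
  move=> z _; rewrite mulmxA -mulmxA -{1}(trmxK x) -trmx_mul.
  rewrite [LHS]mxE big_ord1 expr2; congr (_ * _); by rewrite mxE.
move=> /eqP; rewrite psumr_eq0; last by move=> *; exact: sqr_ge0.
move=> /allP h; apply/matrixP => i j; rewrite ord1 [RHS]mxE.
have /h : f j \in H by exact: forest_basis_mem bf.
rewrite sqrf_eq0 => /eqP <-; rewrite [RHS]mxE (bigD1 j) //= !mxE.
rewrite (grad_basis R ho _ _ bf) eqxx mul1r big1 ?addr0 // => l lj.
by rewrite mxE (grad_basis R ho _ _ bf) eq_sym (negPf lj) mul0r.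
Qed.

Definition minor m (g : 'I_m -> edge G) : R :=
  \det (coefmx f g *m invmx gram *m (coefmx f g)^T).

Lemma coefmx_extend m (g : 'I_m -> edge G) z :
  coefmx f (extend g z) = col_mx (coefmx f g) (coefrow z).
Proof.
apply/matrixP => i j; rewrite -(splitK i); case: (fintype.split i) => i' /=.
  by rewrite col_mxEu !mxE extend_lshift.
by rewrite col_mxEd !mxE extend_rshift.
Qed.

Lemma minor_noninj m (g : 'I_m -> edge G) i j :
  i != j -> g i = g j -> minor g = 0.
Proof.
move=> ij gij; apply: (determinant_alternate ij) => k.
by rewrite !mxE; apply: eq_bigr => l _; rewrite !mxE; congr (_ * _);
  apply: eq_bigr => l' _; rewrite !mxE gij.
Qed.

(* As functions of [g], both sides satisfy the same recursion when summed over the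
   extensions of [g] by one edge, and they agree when [g] has [r] edges. *)
Lemma forests_minor m (g : 'I_m -> edge G) : injective g ->
  (forall i, inH (g i)) -> forests_containing g = \det gram * minor g.
Proof.
(* For [m > r] both sides vanish: no forest has that many edges, and the matrix has rank at most
   [r]. *)
have [|rm] := leqP m r; last first.
  move=> gI gH; rewrite /forests_containing big_seq big1 => [|T TB]; last first.
    have [f' bf' ->] := forest_enum_basis TB.
    by case: forallP => // /(im_contained gI)[]; rewrite leqNgt rm.
  rewrite /minor; set A := _ *m _; suff -> : \det A = 0 by rewrite mulr0.
  apply/eqP; rewrite -[_ == 0]negbK -unitfE -unitmxE -row_free_unit -row_leq_rank -ltnNge.
  by apply: leq_ltn_trans rm; rewrite /A -mulmxA; apply: leq_trans (mulmx_max_rank _ _) _.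
move Ek : (r - m)%N => k; elim: k => [|k IHk] in m g Ek *.
  move=> mr gI gH; have {}mr : m = r by lia.
  subst m; rewrite forests_basis // /minor !det_mulmx det_tr det_inv expr2.
  have := gram_unit; rewrite unitmxE unitfE => g0; by field.
move=> mr gI gH; have r0 : r%:R - m%:R != 0 :> R.
  by rewrite subr_eq0 eqr_nat; lia.
apply: (mulfI r0); rewrite -forests_extend // mulrCA.
rewrite -(@sum_det_bordered _ _ (H : seq _) _ _ coefrow); last by rewrite mulVmx ?gram_unit.
rewrite mulr_sumr; apply: eq_big_seq => z zH; rewrite -coefmx_extend.
case: ifPn => [/codomP[i zi]|zg]; last first.
  apply: IHk; [lia|lia|exact: extend_inj|].
  by apply/(extendP g z inH).
rewrite -/(minor _) (@minor_noninj _ _ (lshift 1 i) (rshift m ord0)) ?mulr0 //.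
  by rewrite eq_lrshift.
by rewrite extend_lshift extend_rshift.
Qed.

(** The combination of branches whose gradient is the column of the projection [K] indexed by
    [e]. *)
Definition potential e : V -> R := fun z =>
  \sum_i branch R o (im f) (f i) z * (invmx gram *m (coefrow e)^T) i 0.

Lemma grad_potential e e' :
  grad o (potential e) e' = (coefrow e' *m invmx gram *m (coefrow e)^T) 0 0.
Proof.
rewrite /grad -sumrB -mulmxA mxE; apply: eq_bigr => i _.
by rewrite [coefrow _ _ _]mxE -mulrBl.
Qed.

(** The projection [K] fixes gradients. This is the weak Poisson equation with a unit source and
    sink at the ends of [e]. *)
Lemma potential_weak e u : inH e ->
  \sum_(z <- H) grad o (potential e) z * grad o u z = grad o u e.
Proof.
move=> eH; pose U : 'cV[R]_r := \col_i grad o u (f i).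
have gU z : inH z -> grad o u z = (U^T *m (coefrow z)^T) 0 0.
  move=> zH; rewrite -trmx_mul [RHS]mxE mxE (grad_expand ho u bf zH).
  by apply: eq_bigr => i _; rewrite !mxE.
rewrite (eq_big_seq (fun z => (U^T *m ((coefrow z)^T *m coefrow z) *m
    (invmx gram *m (coefrow e)^T)) 0 0)); last first.
  move=> z zH; rewrite mulrC grad_potential gU // (mulmxA U^T).
  by rewrite -(mulmxA _ (coefrow z)) [RHS]mxE big_ord1 -(mulmxA (coefrow z)).
rewrite -summxE -mulmx_suml -mulmx_sumr -/gram mulmxA -mulmxA -mulmxA.
by rewrite (mulmxA gram) mulmxV ?gram_unit // mul1mx gU.
Qed.

End WithBasis.

Lemma transfer_current_finite : B != fset0 ->
  exists v : edge G -> V -> R,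
    (forall e u, e \in H ->
       \sum_(z <- H) grad o (v e) z * grad o u z = grad o u e) /\
    (forall m (g : 'I_m -> edge G), injective g -> (forall i, g i \in H) ->
       forests_containing g =
       #|` B|%:R * \det (\matrix_(i, j) grad o (v (g i)) (g j))).
Proof.
move=> /fset0Pn[T /forest_enum[r [f bf _]]].
exists (potential f); split=> [e u eH|m g gI gH]; first exact: potential_weak.
rewrite (forests_minor bf gI gH).
(* The empty family lies in every forest and has minor 1; this is a form of the matrix-tree
   theorem. *)
have -> : #|` B|%:R = \det (gram f).
  transitivity (forests_containing (fun i : 'I_0 => f (widen_ord (leq0n r) i))).
    rewrite /forests_containing (eq_bigr (fun=> 1)).
      by rewrite big_const_seq count_predT iter_addr_0.
    by move=> S _; case: forallP => // -[] [].
  rewrite (forests_minor bf) ?/minor ?det_mx00 ?mulr1 //; by case.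
congr (_ * _); rewrite -det_tr; congr (\det _).
apply/matrixP => i j; rewrite [RHS]mxE [RHS]mxE grad_potential !mxE.
apply: eq_bigr => k _; rewrite !mxE; congr (_ * _).
by apply: eq_bigr => l _; rewrite !mxE.
Qed.

End ForestCount.

(** * Harmonic functions on periodic graphs *)

Section Laplacian.
Variables (R : realType) (V : choiceType) (G : multigraph V) (D : nat).
Hypothesis Dreg : regular G D.
Implicit Types (e : edge G) (x y : V) (u v w : V -> R).

Definition incidence x : {fset edge G} := fset_set [set e | incident e x].

Lemma finite_incident x : finite_set [set e : edge G | incident e x].
Proof. by exists D. Qed.

Lemma in_incidence x e : (e \in incidence x) = incident e x.
Proof. by rewrite in_fset_set ?mem_setE //; exact: finite_incident. Qed.

Lemma card_incidence x : #|` incidence x| = D.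
Proof. exact: card_fset_set. Qed.

(** On a [D]-regular graph this is [D (I - A)]; a self-edge contributes 0. *)
Definition laplacian v x : R := \sum_(e <- incidence x) (v x - v (other_end e x)).

Lemma laplacianE v x :
  laplacian v x = D%:R * v x - \sum_(e <- incidence x) v (other_end e x).
Proof.
rewrite /laplacian sumrB big_const_seq count_predT -/(size _) iter_addr_0.
by rewrite card_incidence mulr_natl.
Qed.

Lemma laplacianB u v x : laplacian (u \- v) x = laplacian u x - laplacian v x.
Proof. by rewrite -sumrB; apply: eq_bigr => e _ /=; ring. Qed.

Lemma laplacian_cst_sub v a x : laplacian (fun y => a - v y) x = - laplacian v x.
Proof. by rewrite -sumrN; apply: eq_bigr => e _ /=; ring. Qed.

(** Harmonicity makes [D%:R * w x] the sum of the values at the neighbors, all nonnegative, so it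
    dominates each of them. *)
Lemma harnack_edge w e x y : (forall z, 0 <= w z) -> laplacian w x = 0 ->
  joins e x y -> w y <= D%:R * w x.
Proof.
move=> w0; rewrite laplacianE => /eqP; rewrite subr_eq0 => /eqP -> exy.
have ix := joins_incidentl exy.
have ein : e \in incidence x by rewrite in_incidence.
rewrite (big_fsetD1 e ein) /=; move: exy; rewrite (joins_other_end _ ix) => /eqP ->.
by rewrite lerDl sumr_ge0.
Qed.

Lemma harnack : connected_graph G -> forall x y, exists2 C : R, 0 <= C &
  forall w, (forall z, 0 <= w z) -> (forall z, laplacian w z = 0) ->
  w y <= C * w x.
Proof.
move=> cG x y; move: x y (cG x y); apply: linked_ind => [x|e x y z exy _ _ [C C0 hC]].
  by exists 1 => // w _ _; rewrite mul1r.
exists (C * D%:R) => [|w w0 hw]; first exact: mulr_ge0.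
apply: le_trans (hC w w0 hw) _; rewrite -mulrA ler_wpM2l //.
exact: harnack_edge exy.
Qed.

End Laplacian.

(** * Translation invariance and the Liouville theorem *)

Section Liouville.
Variables (R : realType) (d k : nat) (G : multigraph (vertex d k)) (D : nat).
Hypothesis Dreg : regular G D.
Hypothesis perG : Defs.periodic G.
Hypothesis conG : connected_graph G.
Implicit Types (e : edge G) (a : 'rV[int]_d) (x y : vertex d k) (w h : vertex d k -> R).

Local Notation lap := (@laplacian R _ G).

Lemma translateD a b x : translate a (translate b x) = translate (b + a) x.
Proof. by rewrite /translate /= addrA. Qed.

Lemma translate0 x : translate 0 x = x.
Proof. by case: x => b i; rewrite /translate /= addr0. Qed.

Lemma translateK a : cancel (translate a) (@translate d k (- a)).
Proof. by move=> x; rewrite translateD subrr translate0. Qed.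

Lemma translateNK a : cancel (translate (- a)) (@translate d k a).
Proof. by move=> x; rewrite translateD addNr translate0. Qed.

(** Periodicity only matches the numbers of edges between pairs of vertices, hence sums over edges
    are regrouped by neighbor. *)
Definition multiplicity x y : nat := \sum_(e <- incidence G x) (other_end e x == y).

Lemma multiplicityE x y n :
  ([set e : edge G | joins e x y] #= `I_n)%card -> multiplicity x y = n.
Proof.
move=> hn; rewrite -(card_fset_set hn) /multiplicity.
have fin : finite_set [set e : edge G | joins e x y] by exists n.
rewrite (eq_bigr (fun e => if other_end e x == y then 1 else 0)%N); last first.
  by move=> e _; case: eqP.
rewrite -big_mkcond /= sum1_count -size_filter; apply/perm_size/uniq_perm.
- by rewrite filter_uniq ?fset_uniq.
- exact: fset_uniq.
move=> e; rewrite mem_filter; apply/andP/idP => [[oy ein]|].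
  have ix : incident e x by rewrite -(in_incidence Dreg).
  by rewrite (in_fset_set fin) inE /= joins_other_end.
move=> ein; have ej : joins e x y by move: ein; rewrite (in_fset_set fin) inE.
have ix := joins_incidentl ej.
by rewrite -joins_other_end ?(in_incidence Dreg).
Qed.

Lemma multiplicity_translate a x y :
  multiplicity (translate a x) (translate a y) = multiplicity x y.
Proof.
have : finite_set [set e : edge G | joins e x y].
  apply: sub_finite_set (finite_incident Dreg x) => e /=; exact: joins_incidentl.
move=> [n hn]; rewrite (multiplicityE hn); apply: multiplicityE.
by apply: card_eq_trans hn; rewrite card_eq_sym; exact: perG.
Qed.

Lemma sum_other_end (Q : seq (vertex d k)) x (F : vertex d k -> R) : uniq Q ->
  (forall e, incident e x -> other_end e x \in Q) ->
  \sum_(e <- incidence G x) F (other_end e x) =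
  \sum_(y <- Q) (multiplicity x y)%:R * F y.
Proof.
move=> uQ hQ; rewrite (eq_bigr (fun y => \sum_(e <- incidence G x)
    (other_end e x == y)%:R * F y)); last first.
  by move=> y _; rewrite -mulr_suml natr_sum.
rewrite exchange_big /=; apply: eq_big_seq => e; rewrite (in_incidence Dreg) => ex.
rewrite (bigD1_seq (other_end e x)) ?hQ //= eqxx mul1r big1 ?addr0 // => y.
by rewrite eq_sym => /negPf ->; rewrite mul0r.
Qed.

Lemma laplacian_translate a h x :
  lap (h \o translate a) x = lap h (translate a x).
Proof.
(* One list indexes both Laplacian sums: the neighbors of [x] and, pulled back, those of
   [translate a x]. *)
pose Q := undup ([seq other_end e x | e <- incidence G x] ++
  [seq translate (- a) (other_end e (translate a x)) | e <- incidence G (translate a x)]).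
have uQ : uniq Q by exact: undup_uniq.
have hQ e : incident e x -> other_end e x \in Q.
  move=> ie; rewrite mem_undup mem_cat; apply/orP; left; apply/mapP; exists e => //.
  by rewrite (in_incidence Dreg).
have uQa : uniq (map (translate a) Q).
  by rewrite map_inj_uniq //; exact: can_inj (translateK a).
have hQa e : incident e (translate a x) ->
    other_end e (translate a x) \in map (translate a) Q.
  move=> ie; apply/mapP; exists (translate (- a) (other_end e (translate a x))); last first.
    by rewrite translateNK.
  rewrite mem_undup mem_cat; apply/orP; right; apply/mapP; exists e => //.
  by rewrite (in_incidence Dreg).
apply: etrans (sum_other_end (fun y => h (translate a x) - h (translate a y)) uQ hQ) _.
apply/esym.
apply: etrans (sum_other_end (fun y => h (translate a x) - h y) uQa hQa) _.
by rewrite big_map; apply: eq_bigr => y _; rewrite multiplicity_translate.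
Qed.

(** Translating [w] reduces the bound to the [k] base points [(0, i)], and the sum of their
    constants dominates each one. *)
Lemma harnack_translate a : exists2 C : R, 0 <= C &
  forall w, (forall z, 0 <= w z) -> (forall z, lap w z = 0) ->
  forall x, w (translate a x) <= C * w x.
Proof.
have /choice[C hC] : forall i : 'I_k, exists C : R, 0 <= C /\
    forall w, (forall z, 0 <= w z) -> (forall z, lap w z = 0) ->
    w (a, i) <= C * w (0, i).
  by move=> i; have [C C0 hC] := harnack R Dreg conG (0, i) (a, i); exists C.
exists (\sum_i C i) => [|w w0 hw [b i]].
  by apply: sumr_ge0 => i _; case: (hC i).
have [C0 /(_ (w \o translate b))] := hC i.
rewrite /translate /= add0r (addrC a) => /(_ (fun=> w0 _)) hCi.
apply: le_trans (hCi _) _ => [z|]; first by rewrite laplacian_translate.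
rewrite ler_wpM2r // (bigD1 i) //= lerDl sumr_ge0 // => j _.
by case: (hC j).
Qed.

(* If the supremum [s] of the increments [h (x + a) - h x] were positive, the
   Harnack inequality would keep the increment close to [s] along a progression
   [x, x + a, x + 2 a, ..] of any given length, and [h] would be unbounded. *)
Lemma bounded_harmonic_increment h (B : R) a : (forall x, `|h x| <= B) ->
  (forall x, lap h x = 0) -> forall x, h (translate a x) <= h x.
Proof.
move=> hB hh x0; pose u x := h (translate a x) - h x.
pose E := [set u x | x in [set: vertex d k]].
have uB x : u x <= 2 * B.
  have := hB (translate a x); have := hB x; rewrite !ler_norml /u.
  by move=> /andP[? ?] /andP[? ?]; lra.
have supE : has_sup E.
  by split; [exists (u x0), x0|exists (2 * B) => _ [x _ <-]].
have us x : u x <= sup E by apply: sup_upper_bound => //; exists x.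
suff s0 : sup E <= 0 by rewrite -subr_le0; exact: le_trans (us x0) s0.
(* [w] is nonnegative and harmonic, and small where the increment is close to its supremum. *)
pose w x := sup E - u x.
have w0 x : 0 <= w x by rewrite subr_ge0.
have hw x : lap w x = 0.
  rewrite laplacian_cst_sub (laplacianB G (h \o translate a) h) laplacian_translate.
  by rewrite !hh subrr oppr0.
have [C C0 hC] := harnack_translate a.
have iterw n x : w (translate (a *+ n) x) <= C ^+ n * w x.
  elim: n => [|n IH]; first by rewrite mulr0n translate0 expr0 mul1r.
  rewrite mulrSr -translateD exprS -mulrA.
  by apply: le_trans (hC w w0 hw _) _; rewrite ler_wpM2l.
have telescope n x : h (translate (a *+ n) x) - h x =
    \sum_(i < n) u (translate (a *+ i) x).
  elim: n => [|n IH]; first by rewrite big_ord0 mulr0n translate0 subrr.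
  by rewrite big_ord_recr /= -IH /u translateD -mulrSr; ring.
(* From a nearly maximal increment, [n] steps fall short of [n] times the supremum by at most
   [S * w x], which is made at most [eps]. *)
have bound n : n%:R * sup E <= 2 * B.
  apply/ler_addgt0Pr => eps eps0.
  pose S := \sum_(i < n) C ^+ i.
  have S0 : 0 <= S by apply: sumr_ge0 => i _; exact: exprn_ge0.
  have S1 : 0 < S + 1 by rewrite ltr_wpDl.
  have [_ [x _ <-] xs] := sup_adherent (divr_gt0 eps0 S1) supE.
  have wx : w x <= eps / (S + 1) by rewrite /w; lra.
  have : n%:R * sup E - S * w x <= 2 * B.
    apply: le_trans (_ : h (translate (a *+ n) x) - h x <= _); last first.
      have := hB (translate (a *+ n) x); have := hB x; rewrite !ler_norml.
      by move=> /andP[? ?] /andP[? ?]; lra.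
    rewrite telescope mulr_suml -[n in n%:R * _]card_ord -sumr_const mulr_suml -sumrB.
    apply: ler_sum => i _; have := iterw i x; rewrite /w mul1r; lra.
  have : S * w x <= eps.
    apply: le_trans (_ : S * (eps / (S + 1)) <= _); first by rewrite ler_wpM2l.
    by rewrite mulrCA ler_piMr ?(ltW eps0) // ler_pdivrMr // mul1r lerDl.
  lra.
rewrite leNgt; apply/negP => s0.
have B0 : 0 <= 2 * B by have := bound 0%N; rewrite mul0r.
have /archi_boundP : 0 <= 2 * B / sup E by exact: divr_ge0 (ltW s0).
by rewrite ltr_pdivrMr // ltNge bound.
Qed.

(** Increments along [a] and [- a] are both nonpositive, so [h] is translation invariant and attains
    its maximum. The Harnack inequality for the maximum minus [h], which vanishes somewhere, makes
    [h] constant. *)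
Lemma liouville h (B : R) : (forall x, `|h x| <= B) ->
  (forall x, lap h x = 0) -> forall x y, h x = h y.
Proof.
move=> hB hh.
have per a x : h (translate a x) = h x.
  apply/eqP; rewrite eq_le (bounded_harmonic_increment _ hB) //=.
  by rewrite -{1}(translateK a x) (bounded_harmonic_increment _ hB).
have type x : h x = h (0, x.2).
  by case: x => b i /=; rewrite -[RHS](per b) /translate /= add0r.
move=> x0 y0; pose i0 := [arg max_(i > x0.2) h (0, i)]%O.
have hmax x : h x <= h (0, i0).
  rewrite type /i0; case: arg_maxP => // i _ imax; exact: imax.
pose w x := h (0, i0) - h x.
have wh x : lap w x = 0 by rewrite laplacian_cst_sub hh oppr0.
have w0 x : 0 <= w x by rewrite subr_ge0.
suff hx x : h x = h (0, i0) by rewrite !hx.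
have [C C0 /(_ w w0 wh)] := harnack R Dreg conG (0, i0) x.
by rewrite {2}/w subrr mulr0 /w => ?; apply/eqP; rewrite eq_le hmax /=; lra.
Qed.

End Liouville.

(** * Potentials on finite subgraphs *)

Section FinitePotentials.
Variables (R : realType) (V : choiceType) (G : multigraph V) (D : nat).
Hypothesis Dreg : regular G D.
Variable o : edge G -> V * V.
Hypothesis ho : forall e, joins e (o e).1 (o e).2.
Variables (H : {fset edge G}).
Implicit Types (e : edge G) (u v : V -> R).

Let weak_solution e v := forall u,
  \sum_(z <- H) grad o v z * grad o u z = grad o u e.

(* Testing against the positive parts of [v - v x] and [v y - v], where [e] is
   oriented from [x] to [y], shows that [v] stays between [v y] and [v x], up to
   a modification that does not change its gradient on [H]. *)
Lemma truncated_solution e v : e \in H -> weak_solution e v ->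
  exists v', [/\ forall z, z \in H -> grad o v' z = grad o v z,
    forall x, 0 <= v' x <= 1 & v' (o e).2 = 0].
Proof.
move=> eH hv; set a := v (o e).1; set b := v (o e).2.
have vv : \sum_(z <- H) grad o v z ^+ 2 = a - b by rewrite -[RHS](hv v).
have ab0 : 0 <= a - b by rewrite -vv sumr_ge0 // => z _; exact: sqr_ge0.
(* The energy is [a - b], and the edge [e] alone contributes [(a - b) ^+ 2] to it. *)
have ab1 : a - b <= 1.
  have : (a - b) ^+ 2 <= a - b.
    rewrite -{2}vv (big_fsetD1 e eH) /= -/(grad o v e) lerDl.
    by rewrite sumr_ge0 // => z _; exact: sqr_ge0.
  by nra.
have vanish u : grad o u e = 0 ->
    (forall z, grad o u z ^+ 2 <= grad o v z * grad o u z) ->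
    forall z, z \in H -> grad o u z = 0.
  move=> ue0 hu z zH; have := hv u; rewrite ue0 => /eqP.
  rewrite psumr_eq0 => [/allP/(_ z zH)/eqP uz|z' _]; last first.
    exact: le_trans (sqr_ge0 _) (hu z').
  by apply/eqP; rewrite -sqrf_eq0 eq_le sqr_ge0 andbT -[leRHS]uz hu.
pose u1 x : R := Num.max 0 (v x - a); pose u2 x : R := Num.min 0 (v x - b).
have g1 : forall z, z \in H -> grad o u1 z = 0.
  apply: vanish => [|z].
    rewrite /grad /u1 -/a -/b subrr maxxx sub0r max_l ?oppr0 //.
    by rewrite -oppr_ge0 opprB.
  rewrite /grad /u1; move: (v _) (v _) => p q.
  by case: (leP 0 (p - a)) => h1; case: (leP 0 (q - a)) => h2; nra.
have g2 : forall z, z \in H -> grad o u2 z = 0.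
  apply: vanish => [|z].
    by rewrite /grad /u2 -/a -/b subrr minxx subr0 min_l.
  rewrite /grad /u2; move: (v _) (v _) => p q.
  by case: (leP 0 (p - b)) => h1; case: (leP 0 (q - b)) => h2; nra.
(* Removing both parts truncates [v] to the interval from [b] to [a]; subtracting [b] normalizes it
   at the head of [e]. *)
exists (fun x => v x - u1 x - u2 x - b); split.
- move=> z zH; have := g1 z zH; have := g2 z zH; rewrite /grad; lra.
- move=> x; rewrite /u1 /u2.
  by case: (leP 0 (v x - a)) => h1; case: (leP 0 (v x - b)) => h2; lra.
- rewrite /u1 /u2 -/b subrr minxx max_l; first by rewrite !subr0 subrr.
  by rewrite -oppr_ge0 opprB.
Qed.

(** Testing against the indicator of [x] leaves only the edges at [x], all of which lie in [H]. *)
Lemma weak_solution_laplacian e v x : weak_solution e v ->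
  (forall z, incident z x -> z \in H) ->
  laplacian G v x = (x == (o e).1)%:R - (x == (o e).2)%:R.
Proof.
move=> hv hx; have := hv (fun y => (x == y)%:R); rewrite [RHS]/grad => <-.
rewrite (eq_bigr (fun z => if incident z x then v x - v (other_end z x) else 0)).
  rewrite -big_mkcond -big_filter; apply: perm_big; apply: uniq_perm.
  - exact: fset_uniq.
  - by rewrite filter_uniq ?fset_uniq.
  move=> z; rewrite mem_filter; apply/idP/andP => [zx|[zx _]].
    have ix : incident z x by rewrite -(in_incidence Dreg).
    by split=> //; exact: hx.
  by rewrite (in_incidence Dreg).
move=> z _; rewrite /grad; case: ifPn => [zx|zx]; last first.
  have := ho z; have [x1|x1] := eqVneq x (o z).1.
    by move/joins_incidentl; rewrite -x1 (negPf zx).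
  have [x2|x2] := eqVneq x (o z).2; last by rewrite subrr mulr0.
  by move/joins_incidentr; rewrite -x2 (negPf zx).
have [z1|z1] := eqVneq x (o z).1.
  have := ho z; rewrite -z1 (joins_other_end _ zx) => /eqP ->.
  by have [<-|] := eqVneq x (o z).2; rewrite ?subrr ?mul0r // subr0 mulr1.
have [z2|z2] := eqVneq x (o z).2.
  have := ho z; rewrite joinsC -z2 (joins_other_end _ zx) => /eqP ->.
  by rewrite sub0r mulrN1 opprB.
by case: (incident_joins (ho z) zx) => ez; [rewrite ez eqxx in z1|rewrite ez eqxx in z2].
Qed.

(** Truncation keeps the gradients on [H], so the determinant formula survives it. *)
Lemma finite_potentials (B : {fset config G}) :
  (forall T : config G, T \in B <-> maximal_spanning_forest (mem H) T) ->
  B != fset0 ->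
  exists v : edge G -> V -> R,
    (forall e, e \in H -> [/\ forall x, 0 <= v e x <= 1, v e (o e).2 = 0 &
       forall x, (forall z, incident z x -> z \in H) ->
         laplacian G (v e) x = (x == (o e).1)%:R - (x == (o e).2)%:R]) /\
    (forall m (g : 'I_m -> edge G), injective g -> (forall i, g i \in H) ->
       forests_containing R B g =
       #|` B|%:R * \det (\matrix_(i, j) grad o (v (g i)) (g j))).
Proof.
move=> hB B0; have [v [hv hdet]] := transfer_current_finite R ho hB B0.
have /choice[v' hv'] : forall e, exists v', e \in H ->
    [/\ forall z, z \in H -> grad o v' z = grad o (v e) z,
    forall x, 0 <= v' x <= 1 & v' (o e).2 = 0].
  move=> e; case: (boolP (e \in H)) => eH; last by exists (fun=> 0).
  have [v' ?] := truncated_solution eH (fun u => hv e u eH).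
  by exists v'.
exists v'; split=> [e eH|m g gI gH].
  have [gv' v01 v0] := hv' e eH; split=> // x; apply: weak_solution_laplacian => u.
  by rewrite -(hv e u eH); apply: eq_big_seq => z zH; rewrite gv'.
rewrite hdet //; congr (_ * \det _); apply/matrixP => i j; rewrite !mxE.
by have [-> //] := hv' (g i) (gH i).
Qed.

End FinitePotentials.

(** * Infinite-volume limit *)

Section Convergence.
Variables (R : realType) (d k : nat) (G : multigraph (vertex d k)) (D : nat).
Hypothesis Dreg : regular G D.
Hypothesis perG : Defs.periodic G.
Hypothesis conG : connected_graph G.

Local Notation lap := (@laplacian R _ G).
Local Notation fspace := {ptws vertex d k -> R}.

Lemma eval_continuous x : continuous (fun f : fspace => f x).
Proof. exact: (@proj_continuous _ (fun=> R) x). Qed.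

Lemma laplacian_continuous x : continuous (fun f : fspace => lap f x).
Proof.
apply: continuous_big; first exact: add_continuous.
move=> e _ f.
exact: (cvgB (@eval_continuous x f) (@eval_continuous (other_end e x) f)).
Qed.

Lemma cluster_closed (T : topologicalType) (F : set_system T) (phi : T -> R)
    (A : set R) (h : T) : closed A -> continuous phi -> cluster F h ->
  F [set f | A (phi f)] -> A (phi h).
Proof.
move=> cA cphi ch FA; apply: cA => U /cphi nU.
by have [f [Af Uf]] := ch _ _ FA nU; exists (phi f).
Qed.

(** Any cluster point of the [v n] solves the same Poisson equation as [g], so by Liouville they
    differ by a constant, fixed by the value 0 at [y]. Compactness then gives convergence of the
    whole sequence. *)
Lemma potentials_cvg (v : nat -> vertex d k -> R) (g c : vertex d k -> R) (B : R) y :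
  (\forall n \near \oo, forall x, 0 <= v n x <= 1) ->
  (\forall n \near \oo, v n y = 0) ->
  (forall x, \forall n \near \oo, lap (v n) x = c x) ->
  (forall x, `|g x| <= B) -> (forall x, lap g x = c x) ->
  forall z, v n z @[n --> \oo] --> g z - g y.
Proof.
move=> v01 vy vc gB gc z; apply/cvgrPdist_le => eps eps0.
apply: contrapT => nconv.
(* Without convergence the bad indices [S] occur infinitely often, so restricting to them gives a
   proper filter, whose cluster points stay at distance at least [eps] at [z]. *)
pose S := [set n | eps <= `|(g z - g y) - v n z|].
pose F := within S \oo.
have FF : ProperFilter F.
  apply: Build_ProperFilter_ex => P FP.
  apply: contrapT => noP; apply: nconv.
  move: FP; rewrite /F /within /=; apply: filterS => n /= Pn.
  rewrite leNgt; apply/negP => lt; apply: noP; exists n; apply: Pn.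
  exact: ltW.
have FoP P : \oo P -> F P.
  by rewrite /F /within /=; apply: filterS => n Pn _.
pose K := [set f : fspace | forall x, `[0, 1]%classic (f x)].
have cK : compact K.
  exact: (@tychonoff _ (fun=> R) (fun=> `[0, 1]%classic) (fun=> @segment_compact R 0 1)).
have [] := cK ((v : nat -> fspace) @ F).
  apply: FoP; apply: filterS v01 => n hn x.
  by have := hn x; rewrite /= in_itv.
move=> h [hK ch].
have hy : h y = 0.
  apply: (cluster_closed (A := [set t | t = 0]) _ (@eval_continuous y) ch) => //.
  exact: FoP.
have hlap x : lap h x = c x.
  apply: (cluster_closed (A := [set t | t = c x]) _ (@laplacian_continuous x) ch) => //.
  apply: FoP; exact: vc.
have : [set t : R | eps <= t] `|(g z - g y) - h z|.
  apply: (cluster_closed (phi := fun f : fspace => `|(g z - g y) - f z|) _ _ ch).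
  - exact: closed_ge.
  - move=> f.
    exact: (cvg_norm (cvgB (cvg_cst (g z - g y)) (@eval_continuous z f))).
  - exact: (@withinT _ \oo S).
rewrite /=; have hb x : `|(h \- g) x| <= 1 + B.
  have := hK x; rewrite /= in_itv /= => /andP[h0 h1].
  by apply: le_trans (ler_normB _ _) _; rewrite lerD // ger0_norm.
have hh x : lap (h \- g) x = 0 by rewrite laplacianB hlap gc subrr.
have /= := liouville Dreg perG conG hb hh z y; rewrite hy => e.
suff -> : g z - g y - h z = 0 by rewrite normr0 leNgt eps0.
by rewrite -[RHS]subr0; lra.
Qed.

End Convergence.

(** * Exhaustion by finite boxes *)

Section Boxes.
Variables (d k : nat) (G : multigraph (vertex d k)) (D : nat).
Hypothesis Dreg : regular G D.

Lemma finite_box n : finite_set [set x : vertex d k | in_box n x].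
Proof.
pose f (p : {ffun 'I_d -> 'I_(2 * n).+1} * 'I_k) : vertex d k :=
  (\row_j ((p.1 j : nat)%:Z - n%:Z), p.2).
apply: sub_finite_set (finite_image f (@finite_finset _ setT)) => -[a i] /forallP /= ha.
exists ([ffun j => inord (absz (a 0 j + n%:Z))], i) => //.
congr (_, _); apply/rowP => j; rewrite mxE ffunE.
have := ha j; rewrite ler_norml => /andP[h1 h2].
rewrite inordK; lia.
Qed.

Lemma finite_box_edges n : finite_set [set e : edge G | @box_subgraph d k G n e].
Proof.
apply: (@sub_finite_set _ _
  (\bigcup_(x in [set x | in_box n x]) [set e : edge G | incident e x])).
  by move=> e /andP[e1 _]; exists (ends e).1 => //=; rewrite /incident eqxx.
apply: bigcup_finite => [|x _]; [exact: finite_box|exact: finite_incident].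
Qed.

Definition box_edges n : {fset edge G} := fset_set [set e : edge G | @box_subgraph d k G n e].

Lemma in_box_edges n e : (e \in box_edges n) = @box_subgraph d k G n e.
Proof. by rewrite in_fset_set ?inE //; [apply/idP/idP; rewrite inE|exact: finite_box_edges]. Qed.

Lemma mem_box_edges n : mem (box_edges n) = @box_subgraph d k G n :> (edge G -> bool).
Proof. by apply/funext => e; rewrite -in_box_edges. Qed.

Lemma near_in_box (x : vertex d k) : \forall n \near \oo, in_box n x.
Proof.
exists (\sum_j absz (x.1 0%R j))%N => // n /= hn; apply/forallP => j.
rewrite -abszE lez_nat; apply: leq_trans hn.
by rewrite (bigD1 j) //= leq_addr.
Qed.

Lemma near_box_edge (e : edge G) : \forall n \near \oo, e \in box_edges n.
Proof.
near=> n; rewrite in_box_edges /box_subgraph.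
by apply/andP; split; near: n; exact: near_in_box.
Unshelve. all: by end_near. Qed.

Lemma near_box_incident (x : vertex d k) :
  \forall n \near \oo, forall e, incident e x -> e \in box_edges n.
Proof.
have := @filter_bigI _ _ (incidence G x) (fun e => [set n | e \in box_edges n]) \oo _.
move=> /(_ _ (fun e _ => near_box_edge e)); apply: filterS => n hn e ie.
by apply: hn => /=; rewrite (in_incidence Dreg).
Qed.

End Boxes.

(** * From complex solutions to real potentials *)

Section Impedance.
Variables (R : realType) (d k : nat) (G : multigraph (vertex d k)) (D : nat).
Hypothesis hG : standing_assumptions G D.
Local Open Scope complex_scope.

Let perG : Defs.periodic G. Proof. by case: hG. Qed.
Let conG : connected_graph G. Proof. by case: hG. Qed.
Let Dreg : regular G D. Proof. by case: hG. Qed.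

Lemma degree_gt0 : (0 < D)%N.
Proof.
have [_ _ _ [e [x exx]]] := hG; rewrite -(card_incidence Dreg x) cardfs_gt0.
by apply/fset0Pn; exists e; rewrite (in_incidence Dreg); exact: joins_incidentl exx.
Qed.

(* [L] will be the real or the imaginary part. *)
Lemma bounded_solution_laplacian (L : R[i] -> R) x y (g : vertex d k -> R[i]) :
  (forall a b, L (a + b) = L a + L b) ->
  bounded_solution G D x y g ->
  forall p, laplacian G (L \o g) p = D%:R * L (delta R x p - delta R y p).
Proof.
move=> LD [_ hg] p.
have L0 : L 0 = 0 by apply: (addrI (L 0)); rewrite -LD !addr0.
have LN a : L (- a) = - L a by apply: (addrI (L a)); rewrite -LD !subrr.
have LMn a n : L (n%:R * a) = n%:R * L a.
  elim: n => [|n IH]; first by rewrite !mul0r.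
  by rewrite -natr1 !mulrDl !mul1r LD IH -natr1 mulrDl mul1r.
have D0 : D%:R != 0 :> R[i] by rewrite pnatr_eq0 -lt0n degree_gt0.
rewrite (laplacianE Dreg) -LMn -hg mulrBr /transition mulVKf //.
rewrite fsbig_finite; last exact: (finite_incident Dreg).
rewrite LD LN /= LMn; congr (_ - _).
by rewrite -/(incidence G p) (big_morph L LD L0).
Qed.

(** The real part divided by [D] is the potential of a unit source and sink. The imaginary part is
    bounded and harmonic, hence constant, and drops out of differences. *)
Lemma bounded_solution_potential x y (g : vertex d k -> R[i]) :
  bounded_solution G D x y g ->
  exists (v : vertex d k -> R) (B : R), [/\ forall z, `|v z| <= B,
    forall z, laplacian G v z = (z == x)%:R - (z == y)%:R
    & forall z w, g z - g w = D%:R * (v z - v w)%:C].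
Proof.
move=> hg; have [[B hB] _] := hg.
have ReD (a b : R[i]) : complex.Re (a + b) = complex.Re a + complex.Re b.
  by case: a b => [? ?] [? ?].
have ImD (a b : R[i]) : complex.Im (a + b) = complex.Im a + complex.Im b.
  by case: a b => [? ?] [? ?].
have D0 : D%:R != 0 :> R by rewrite pnatr_eq0 -lt0n degree_gt0.
have deltaE p : delta R x p - delta R y p = ((p == x)%:R - (p == y)%:R)%:C.
  by rewrite /delta rmorphB /= !rmorph_nat.
have boundRe z : `|complex.Re (g z)| <= B.
  by rewrite -lecR; apply: le_trans (hB z); exact: normc_ge_Re.
have boundIm z : `|complex.Im (g z)| <= B.
  rewrite -lecR; apply: le_trans (hB z).
  by rewrite normc_def lecR -sqrtr_sqr ler_wsqrtr // lerDr sqr_ge0.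
exists (fun z => complex.Re (g z) / D%:R), (B / D%:R); split.
- move=> z; rewrite normrM normfV normr_nat ler_wpM2r ?invr_ge0 ?ler0n //.
- move=> z; have := bounded_solution_laplacian ReD hg z; rewrite deltaE /=.
  rewrite /laplacian /= => h; apply: (mulfI D0); rewrite -h mulr_sumr.
  by apply: eq_bigr => e _; field.
- move=> z w.
  have hIm : complex.Im (g z) = complex.Im (g w).
    apply: (liouville Dreg perG conG boundIm) => p.
    by rewrite (bounded_solution_laplacian ImD hg) deltaE /= mulr0.
  rewrite -(rmorph_nat (real_complex R)) -rmorphM /= -mulrBl mulrCA divff // mulr1.
  move: hIm; case: (g z) (g w) => [a b] [a' b'] /= ->.
  by apply/eqP; rewrite eq_complex /= subrr !eqxx.
Qed.

End Impedance.

(** * Cylinder events *)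

Section Cylinders.
Variables (R : realType) (V : choiceType) (G : multigraph V).
Variables (m : nat) (e : 'I_m -> edge G).

Definition cylinder : set (config G) := [set T | forall i, T (e i)].

Lemma nbhs_cylinder (T : config G) : nbhs T [set S : config G | forall i, S (e i) = T (e i)].
Proof.
have near1 i : nbhs T [set S : config G | S (e i) = T (e i)].
  have /= := @proj_continuous _ (fun=> bool) (e i) T.
  by move=> /(_ [set T (e i)]); apply; exact: discrete_set1.
have := @filter_bigI _ _ [fset i | i in 'I_m]%fset
  (fun i => [set S : config G | S (e i) = T (e i)]) (nbhs T) _.
move=> /(_ _ (fun i _ => near1 i)); apply: filterS => S hS i.
by apply: (hS i); rewrite /= inE.
Qed.

Lemma measurable_cylinder : measurable cylinder.
Proof.
apply: sub_sigma_algebra; rewrite /= openE => T hT.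
by apply: filterS (nbhs_cylinder T) => S hS i; rewrite hS.
Qed.

Lemma continuous_indic_cylinder : continuous (\1_cylinder : config G -> R).
Proof.
move=> T U hU; apply: filterS (nbhs_cylinder T) => S hS /=.
suff -> : \1_cylinder S = \1_cylinder T :> R by exact: nbhs_singleton.
rewrite !indicE; congr (_%:R); congr (nat_of_bool _).
by apply/idP/idP; rewrite !inE => h i; have := h i; rewrite hS.
Qed.

(** A cylinder over finitely many edges is open and closed, so its indicator is a continuous test
    function. *)
Lemma weak_limit_cylinder (mun : nat -> probability (config G) R)
    (mu : probability (config G) R) : weak_limit mun mu ->
  mun n cylinder @[n --> \oo] --> mu cylinder.
Proof.
move=> /(_ _ continuous_indic_cylinder).
have E (nu : probability (config G) R) :
    (\int[nu]_T (\1_cylinder T)%:E = nu cylinder)%E.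
  by rewrite integral_indic ?setIT //; exact: measurable_cylinder.
by rewrite E; under eq_cvg do rewrite E.
Qed.

(** [fset_set] sends an infinite set to the empty one, and division by 0 yields 0; either would
    contradict total mass 1. *)
Lemma uniform_on_finite (A : set (config G)) (mu : probability (config G) R) :
  uniform_on A mu -> fset_set A != fset0 /\ finite_set A.
Proof.
move=> /(_ _ measurableT); rewrite probability_setT setIT => -[h].
have A0 : fset_set A != fset0.
  by apply/eqP => A0; move: h; rewrite A0 cardfs0 mul0r => /eqP; rewrite oner_eq0.
split=> //; apply: contrapT => nfA; case/negP: A0.
by rewrite /fset_set; case: pselect => // fA; case: (nfA fA).
Qed.

Lemma uniform_on_cylinder (A : set (config G)) (mu : probability (config G) R) :
  uniform_on A mu ->
  mu cylinder = (forests_containing R (fset_set A) e / #|` fset_set A|%:R)%:E.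
Proof.
move=> hmu; have [_ fA] := uniform_on_finite hmu.
rewrite hmu; last exact: measurable_cylinder.
congr (_ / _)%:E; rewrite /forests_containing.
rewrite (eq_bigr (fun T : config G => if [forall i, T (e i)] then 1 else 0)); last first.
  by move=> T _; case: ifP.
rewrite -big_mkcond -big_filter big_const_seq count_predT iter_addr_0.
congr (_%:R); apply/perm_size/uniq_perm.
- exact: fset_uniq.
- by rewrite filter_uniq ?fset_uniq.
have fAC : finite_set (A `&` cylinder) by exact: finite_setIl.
move=> T; apply/idP/idP.
  rewrite (in_fset_set fAC) inE => -[AT CT]; rewrite mem_filter; apply/andP; split.
    by apply/forallP.
  by rewrite (in_fset_set fA) inE.
rewrite mem_filter => /andP[/forallP CT]; rewrite (in_fset_set fA) inE => AT.
by rewrite (in_fset_set fAC) inE.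
Qed.

End Cylinders.

Lemma cvg_det (R : realType) m (A : nat -> 'M[R]_m) (M : 'M[R]_m) :
  (forall i j, A n i j @[n --> \oo] --> M i j) ->
  \det (A n) @[n --> \oo] --> \det M.
Proof.
move=> hA; apply: (@cvg_big _ _ +%R 0); first exact: add_continuous.
move=> s _; apply: cvgM; first exact: cvg_cst.
refine (@cvg_big R _ *%R 1 xpredT mul_continuous _ _ _ _ _ _ _).
by move=> i _; exact: hA.
Qed.

(** * Comparison of the two limits *)

Local Open Scope complex_scope.

Theorem theorem4p2 (R : realType) (d k : nat) (hd : (1 <= d)%N)
  (hk : (1 <= k)%N) (G : multigraph (vertex d k)) (D : nat)
  (hG : standing_assumptions G D)
  (m : nat) (e : 'I_m -> edge G) (he : injective e)
  (x y : 'I_m -> vertex d k) (hxy : forall i, joins (e i) (x i) (y i))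
  (M : 'M[R[i]]_m) (hM : transfer_impedance G D x y M)
  (disp : measure_display) (Omega : measurableType disp)
  (P : probability Omega R) (T : {RV P >-> config G})
  (hT : essential_forest_measure (distribution P T)) :
  (fine (P [set w | forall i, T w (e i)]))%:C = \det M.
Proof.
have [perG conG Dreg _] := hG; have [mun [hmun /weak_limit_cylinder - /(_ _ e) hlim]] := hT.
(* The prescribed orientation on the [e i], the listed ends elsewhere. *)
pose o f := if [pick i | e i == f] is Some i then (x i, y i) else ends f.
have ho f : joins f (o f).1 (o f).2.
  rewrite /o; case: pickP => [i /eqP <- //|_]; exact: joins_ends.
have oe i : o (e i) = (x i, y i).
  rewrite /o; case: pickP => [j /eqP/he -> //|/(_ i)]; by rewrite eqxx.
(* [transfer_impedance] allows a different solution for each entry, so the potentials are indexed by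
   pairs. *)
have /choice[vinf hvinf] : forall ij : 'I_m * 'I_m, exists v : vertex d k -> R,
    (exists B : R, forall z, `|v z| <= B) /\
    (forall z, laplacian G v z = (z == x ij.1)%:R - (z == y ij.1)%:R) /\
    M ij.1 ij.2 = (v (x ij.2) - v (y ij.2))%:C.
  move=> [i j] /=; have [g hg gM] := hM i j.
  have [v [B [vB vlap vg]]] := bounded_solution_potential hG hg.
  exists v; split; [by exists B|split=> //].
  have D0 : D%:R != 0 :> R[i] by rewrite pnatr_eq0 -lt0n (degree_gt0 hG).
  by apply: (mulfI D0); rewrite gM vg.
pose minf := \matrix_(i, j) (vinf (i, j) (x j) - vinf (i, j) (y j)).
have MinfE : M = map_mx (real_complex R) minf.
  by apply/matrixP => i j; rewrite !mxE; have [_ [_ ->]] := hvinf (i, j).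
pose B n := fset_set (maximal_spanning_forest (@box_subgraph d k G n)).
have B0 n : B n != fset0 by have [] := uniform_on_finite (hmun n).
have hB n (S : config G) :
    S \in B n <-> maximal_spanning_forest (mem (box_edges G n)) S.
  rewrite (mem_box_edges Dreg n) /B in_fset_set; last by have [] := uniform_on_finite (hmun n).
  by rewrite inE.
have /choice[v hv] := fun n => finite_potentials R Dreg ho (hB n) (B0 n).
have vcvg i j : grad o (v n (e i)) (e j) @[n --> \oo] --> minf i j.
  have [[Bd vB] [vlap _]] := hvinf (i, j).
  have near_e := near_box_edge Dreg (e i).
  (* The finite-volume potentials vanish at [y i], so the limit is normalized there; the constant
     cancels in the gradient on [e j]. *)
  have hc : forall z, v n (e i) z @[n --> \oo] --> vinf (i, j) z - vinf (i, j) (y i).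
    apply: (potentials_cvg Dreg perG conG _ _ _ vB vlap).
    - apply: filterS near_e => n /(proj1 (hv n))[h _ _]; exact: h.
    - by apply: filterS near_e => n /(proj1 (hv n))[_ h _]; rewrite oe in h.
    - move=> z; apply: filterS2 near_e (near_box_incident Dreg z) => n.
      by move=> /(proj1 (hv n))[_ _ h] /h ->; rewrite oe.
  rewrite mxE /grad oe /=.
  have -> : vinf (i, j) (x j) - vinf (i, j) (y j) =
    (vinf (i, j) (x j) - vinf (i, j) (y i)) - (vinf (i, j) (y j) - vinf (i, j) (y i)) by ring.
  by apply: cvgB; exact: hc.
pose A n : 'M[R]_m := \matrix_(i, j) grad o (v n (e i)) (e j).
have detcvg : \det (A n) @[n --> \oo] --> \det minf.
  by apply: cvg_det => i j; under eq_cvg do rewrite mxE; exact: vcvg.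
have muncvg : mun n (cylinder e) @[n --> \oo] --> (\det minf)%:E.
  have : (\det (A n))%:E @[n --> \oo] --> (\det minf)%:E.
    by apply: cvg_EFin; [exact: nearW|exact: detcvg].
  (* As soon as the box contains every [e i], the probability equals the determinant. *)
  apply: cvg_trans; apply: near_eq_cvg.
  have near_all : \forall n \near \oo, forall i, e i \in box_edges G n.
    have := @filter_bigI _ _ [fset i | i in 'I_m]%fset
      (fun i => [set n | e i \in box_edges G n]) \oo _.
    move=> /(_ _ (fun i _ => near_box_edge Dreg (e i))); apply: filterS => n h i.
    by apply: (h i); rewrite /= inE.
  apply: filterS near_all => n hn.
  rewrite (uniform_on_cylinder _ (hmun n)) -/(B n) (proj2 (hv n)) //.
  rewrite mulrAC divff ?mul1r // pnatr_eq0 cardfs_eq0; exact: B0.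
have PE : P [set w | forall i, T w (e i)] = (\det minf)%:E.
  exact: (cvg_unique _ hlim muncvg).
by rewrite PE MinfE det_map_mx.
Qed.
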